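(* Let $\mathcal{H}_1$ and $\mathcal{H}_2$ be two real Hilbert spaces, and let $C\subset\mathcal{H}_1$ and $Q\subset\mathcal{H}_2$ be nonempty, closed and convex subsets. Let $X$ be a Banach space and let $\varphi:\mathcal{H}_1\times X\to\mathbb{R}$ and $\psi:\mathcal{H}_2\times X\to\mathbb{R}$ be two continuous functions. Let $\mathcal{B}_1:\mathcal{H}_1\times X\to 2^{\mathcal{H}_1}$ and $\mathcal{B}_2:\mathcal{H}_2\times X\to 2^{\mathcal{H}_2}$ be two strict weakly compact-valued and $H$-continuous mappings, and let $A:\mathcal{H}_1\to\mathcal{H}_2$ be a bounded linear operator. Then the family $\mathcal{PSMVIP}$ of parametric split multivalued variational inequality problems associated with these data is LP well-posed if and only if for every $p\in X$, $$S_p(\delta,\epsilon)\neq\emptyset \quad \forall\,\delta,\epsilon>0 \quad\text{and}\quad \operatorname{diam}(S_p(\delta,\epsilon))\to 0 \text{ as } (\delta,\epsilon)\to(0,0).$$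
   Context: Data: real Hilbert spaces $\mathcal{H}_1,\mathcal{H}_2$; sets $C\subset\mathcal{H}_1$, $Q\subset\mathcal{H}_2$; a Banach space $X$; functions $\varphi:\mathcal{H}_1\times X\to\mathbb{R}$, $\psi:\mathcal{H}_2\times X\to\mathbb{R}$; multivalued mappings $\mathcal{B}_i:\mathcal{H}_i\times X\to 2^{\mathcal{H}_i}$ ($i=1,2$); a bounded linear operator $A:\mathcal{H}_1\to\mathcal{H}_2$. The product $\mathcal{H}_1\times\mathcal{H}_2$ carries its usual Hilbert space structure. A multivalued mapping is strict if all its values are nonempty. It is weakly compact-valued if each of its values is a weakly compact set. Hausdorff metric: for nonempty sets $M,N$ in a Hilbert space, $d(a,N)=\inf_{b\in N}\|a-b\|$, $D(M,N)=\sup_{a\in M}d(a,N)$, $H(M,N)=\max\{D(M,N),D(N,M)\}$. A strict weakly compact-valued mapping $B:\mathcal{H}\times X\to 2^{\mathcal{H}}$ is $H$-continuous if for every $(x,p)\in\mathcal{H}\times X$ and every $\epsilon>0$ there is $\delta>0$ such that $H(B(x,p),B(y,q))<\epsilon$ for all $(y,q)\in\mathcal{H}\times X$ with $\|(x,p)-(y,q)\|<\delta$ (product norm). For $p\in X$, problem (PSMVIP$_p$) is: find $(x^*,y^* )\in\mathcal{H}_1\times\mathcal{H}_2$ for which there exists $(u^*,v^* )\in\mathcal{B}_1(x^*,p)\times\mathcal{B}_2(y^*,p)$ such that $x^*\in C$, $y^*\in Q$, $y^*=Ax^*$, $\langle u^*,x^*-x\rangle+\varphi(x^*,p)-\varphi(x,p)\le0$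 for all $x\in C$, and $\langle v^*,y^*-y\rangle+\psi(y^*,p)-\psi(y,p)\le0$ for all $y\in Q$. Its solution set is $S_p$. $\mathcal{PSMVIP}$ denotes the family of problems $\{(\mathrm{PSMVIP}_p):p\in X\}$. Let $p\in X$ and $\{p_n\}\subset X$ with $p_n\to p$. A sequence $\{(x_n,y_n)\}\subset\mathcal{H}_1\times\mathcal{H}_2$ is a generalized approximating sequence for (PSMVIP$_p$) corresponding to $\{p_n\}$ if there exist $u_n\in\mathcal{B}_1(x_n,p_n)$, $v_n\in\mathcal{B}_2(y_n,p_n)$ and real numbers $\epsilon_n>0$ with $\epsilon_n\to0$ such that, for every $n$, $d(x_n,C)\le\epsilon_n$, $d(y_n,Q)\le\epsilon_n$, $\|y_n-Ax_n\|\le\epsilon_n$, $\langle u_n,x_n-x\rangle+\varphi(x_n,p_n)-\varphi(x,p_n)\le\epsilon_n$ for all $x\in C$, and $\langle v_n,y_n-y\rangle+\psi(y_n,p_n)-\psi(y,p_n)\le\epsilon_n$ for all $y\in Q$. $\mathcal{PSMVIP}$ is LP (Levitin-Polyak) well-posed if for each $p\in X$, $S_p$ is a singleton and for each sequence $\{p_n\}\subset X$ with $p_n\to p$, every generalized approximating sequence for (PSMVIP$_p$) corresponding to $\{p_n\}$ converges (in norm) to the unique solution. For $p\in X$ and $\delta,\epsilon>0$, $S_p(\delta,\epsilon)$ is the union, over all $q$ in the closed ball $\mathbb{B}(p,\delta)\subset X$ of center $p$ and radius $\delta$, of the sets of all $(z,w)\in\mathcal{H}_1\times\mathcal{H}_2$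 such that $d(z,C)\le\epsilon$, $d(w,Q)\le\epsilon$, $\|w-Az\|\le\epsilon$, and there exist $u\in\mathcal{B}_1(z,q)$, $v\in\mathcal{B}_2(w,q)$ with $\langle u,z-x\rangle+\varphi(z,q)-\varphi(x,q)\le\epsilon$ for all $x\in C$ and $\langle v,w-y\rangle+\psi(w,q)-\psi(y,q)\le\epsilon$ for all $y\in Q$. The diameter of a set $M$ is $\operatorname{diam}(M)=\sup\{\|a-b\|:a,b\in M\}$ (possibly $+\infty$). *)

(* Defs.v *)
From HB Require Import structures.
From mathcomp Require Import all_boot all_order all_algebra.
From mathcomp Require Import all_classical all_reals all_analysis.

Set Implicit Arguments.
Unset Strict Implicit.
Unset Printing Implicit Defensive.

Import Order.TTheory GRing.Theory Num.Theory.
Import numFieldNormedType.Exports.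

Local Open Scope classical_set_scope.
Local Open Scope ring_scope.

(* [theta := idfun] makes the positive definite hermitian form [inner] a
   symmetric bilinear one, i.e. a real inner product. *)
HB.mixin Record NormedModule_isInnerProduct (R : realType) H
    & NormedModule R H := {
  inner : {dot H for (@idfun R)};
  inner_normE : forall x : H, inner x x = `|x| ^+ 2
}.

#[short(type="hilbertType")]
HB.structure Definition Hilbert (R : realType) :=
  {H of CompleteNormedModule R H & NormedModule_isInnerProduct R H}.

Notation "'<< u , v >>_H" := (inner u v)
  (at level 0, u, v at level 99, format "''<<' u ,  v '>>_H'") : ring_scope.

(* A copy of [V] with the weak topology: the supremum of the initial topologies
   of the norm-continuous linear functionals. *)
Definition weak_topology (R : realType) (V : normedModType R) :
    topologicalType :=
  @sup_topology V {f : {scalar V} | continuous (f : V -> R)}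
    (fun f => Topological.class (initial_topology (projT1 f : V -> R))).

Definition weakly_compact (R : realType) (V : normedModType R) (M : set V) :=
  @compact (weak_topology V) M.

(* Extended real infima and suprema, so that the excess of an unbounded set is
   [+oo] instead of the default value of a real supremum. *)
Section Distances.
Context {R : realType} {V : normedModType R}.
Local Open Scope ereal_scope.

Definition dist_to (a : V) (N : set V) : \bar R :=
  ereal_inf [set (`|a - b|%R)%:E | b in N].

Definition hausdorff_excess (M N : set V) : \bar R :=
  ereal_sup [set dist_to a N | a in M].

Definition hausdorff_dist (M N : set V) : \bar R :=
  maxe (hausdorff_excess M N) (hausdorff_excess N M).

End Distances.

Section MultivaluedMaps.
Context {R : realType} {H X : normedModType R}.
Implicit Type B : H * X -> set H.

Definition strict_map B := forall z, B z !=set0.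

Definition weakly_compact_valued B := forall z, weakly_compact (B z).

(* [`|z - w|] is the library's norm on the product, the max norm. *)
Definition H_continuous B :=
  forall (z : H * X) (eps : R), 0 < eps ->
    exists2 delta : R, 0 < delta &
      forall w : H * X, `|z - w| < delta ->
        (hausdorff_dist (B z) (B w) < eps%:E)%E.

End MultivaluedMaps.

Section HilbertProduct.
Context {R : realType} {H1 H2 : hilbertType R}.

(* The library's norm on [H1 * H2] is the max norm, whereas this is the norm
   of the inner product [<<x, x'>> + <<y, y'>>]. *)
Definition hprod_norm (z : H1 * H2) : R :=
  Num.sqrt (`|z.1| ^+ 2 + `|z.2| ^+ 2).

Definition hprod_diam (M : set (H1 * H2)) : \bar R :=
  ereal_sup [set (hprod_norm (a - b))%:E | a in M & b in M].

End HilbertProduct.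

Section ParametricSplitMVIP.
Context {R : realType} {H1 H2 : hilbertType R} {X : completeNormedModType R}.
Variables (C : set H1) (Q : set H2).
Variables (phi : H1 * X -> R) (psi : H2 * X -> R).
Variables (B1 : H1 * X -> set H1) (B2 : H2 * X -> set H2).
Variable A : {linear H1 -> H2}.

Definition psmvip_solutions (p : X) : set (H1 * H2) :=
  [set z | exists u v,
    [/\ B1 (z.1, p) u, B2 (z.2, p) v, C z.1, Q z.2 & z.2 = A z.1] /\
    (forall x, C x -> '<<u, z.1 - x>>_H + phi (z.1, p) - phi (x, p) <= 0) /\
    (forall y, Q y -> '<<v, z.2 - y>>_H + psi (z.2, p) - psi (y, p) <= 0)].

(* [z] satisfies the problem with parameter [q] up to the error [eps], with
   [u] and [v] as the selected elements of the values of [B1] and [B2]. *)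
Definition psmvip_approx (q : X) (eps : R) (z : H1 * H2) (u : H1) (v : H2) :=
  [/\ B1 (z.1, q) u & B2 (z.2, q) v] /\
  [/\ (dist_to z.1 C <= eps%:E)%E, (dist_to z.2 Q <= eps%:E)%E
    & `|z.2 - A z.1| <= eps] /\
  (forall x, C x -> '<<u, z.1 - x>>_H + phi (z.1, q) - phi (x, q) <= eps) /\
  (forall y, Q y -> '<<v, z.2 - y>>_H + psi (z.2, q) - psi (y, q) <= eps).

Definition generalized_approximating_seq
    (p_ : nat -> X) (z_ : nat -> H1 * H2) :=
  exists (u_ : nat -> H1) (v_ : nat -> H2) (eps_ : nat -> R),
    [/\ forall n, 0 < eps_ n, eps_ @ \oo --> (0 : R)
      & forall n, psmvip_approx (p_ n) (eps_ n) (z_ n) (u_ n) (v_ n)].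

Definition LP_well_posed :=
  forall p : X, exists zbar : H1 * H2,
    psmvip_solutions p = [set zbar] /\
    forall p_ : nat -> X, p_ @ \oo --> p ->
    forall z_ : nat -> H1 * H2, generalized_approximating_seq p_ z_ ->
      hprod_norm (z_ n - zbar) @[n --> \oo] --> (0 : R).

Definition psmvip_approx_solutions (p : X) (delta eps : R) : set (H1 * H2) :=
  \bigcup_(q in closed_ball_ Num.norm p delta)
    [set z | exists u v, psmvip_approx q eps z u v].

End ParametricSplitMVIP.

(* Main.v *)
Require Import Defs.
From HB Require Import structures.
From mathcomp Require Import all_boot all_order all_algebra.
From mathcomp Require Import all_classical all_reals all_analysis.
From mathcomp Require Import ring lra.

Import Order.TTheory GRing.Theory Num.Theory.
Import numFieldNormedType.Exports.

Local Open Scope classical_set_scope.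
Local Open Scope ring_scope.

Set Implicit Arguments.
Unset Strict Implicit.

(** The sets of approximate solutions shrink with their tolerances and all
    contain the solution set. A generalized approximating sequence eventually
    enters each of them, and conversely a choice of approximate solutions with
    tolerances [1 / n.+1] is a generalized approximating sequence.

    If the family is well-posed with solution [zbar], the approximate solutions
    are uniformly close to [zbar] for small tolerances: otherwise approximate
    solutions of tolerance [1 / n.+1] that stay away from [zbar] would form an
    approximating sequence that does not converge to [zbar]
    ([approx_solutions_near_of_seq]). So the diameters tend to 0.

    Conversely, choose an approximate solution of tolerance [1 / n.+1] for each
    [n]. Since the diameters tend to 0, this sequence is Cauchy, and its limit
    is a solution ([approximating_seq_limit]). The solution and the terms of any
    approximating sequence lie in common sets of small diameter, whence
    uniqueness and convergence.

    The analytic core is the passage to the limit in the variational inequality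
    ([variational_inequality_limit]). By Hausdorff continuity, the multipliers
    [u_ n] are asymptotic in norm to elements [w_ n] of the limit value of the
    multivalued map. That value is weakly compact, so [w_] has a weak cluster
    point [u] in it. By the uniform boundedness principle the value is also
    bounded in norm ([weakly_compact_norm_bounded]), hence
    [<<u_ n, x_ n - c>> - <<w_ n, x - c>>] tends to 0 when [x_] tends to [x],
    and the inequality satisfied by [u_ n] passes to [u]. *)

(** * The inner product *)

Section InnerProduct.
Context {R : realType} {H : hilbertType R}.
Implicit Types u v w : H.

Lemma innerC u v : '<<u, v>>_H = '<<v, u>>_H.
Proof. by rewrite (hermC (inner : {dot H for (@idfun R)})) expr0 mul1r. Qed.

Lemma innerBl u v w : '<<u - v, w>>_H = '<<u, w>>_H - '<<v, w>>_H.
Proof. exact: linearBl. Qed.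

Lemma innerBr u v w : '<<u, v - w>>_H = '<<u, v>>_H - '<<u, w>>_H.
Proof. exact: linearBr. Qed.

Lemma innerZr (a : R) u v : '<<u, a *: v>>_H = a * '<<u, v>>_H.
Proof. exact: linearZr_LR. Qed.

Lemma innerZl (a : R) u v : '<<a *: u, v>>_H = a * '<<u, v>>_H.
Proof. by rewrite innerC innerZr innerC. Qed.

Lemma inner_scalar u : scalar (inner u : H -> R).
Proof. by move=> a x y; rewrite linearPr. Qed.

Lemma inner_cauchy_schwarz u v : `|'<<u, v>>_H| <= `|u| * `|v|.
Proof.
have [->|v0] := eqVneq v 0; first by rewrite linear0r !normr0 mulr0.
have nv : 0 < `|v| ^+ 2 by rewrite exprn_gt0 // normr_gt0.
have := sqr_ge0 (`|(`|v| ^+ 2) *: u - '<<u, v>>_H *: v|).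
rewrite -inner_normE innerBl !innerBr !innerZl !innerZr.
rewrite !inner_normE (innerC v u) => h.
rewrite -(@ler_pXn2r _ 2%N) ?nnegrE ?mulr_ge0 //.
rewrite real_normK ?num_real // exprMn -(ler_pM2r nv).
rewrite -subr_ge0; apply: le_trans h _; rewrite le_eqVlt; apply/orP; left.
apply/eqP; ring.
Qed.
End InnerProduct.

(** * Weakly compact sets *)

Lemma linear_bounded_by_continuous (R : realType) (V W : normedModType R)
    (f : {linear V -> W}) (M : R) :
  (forall x, `|f x| <= M * `|x|) -> continuous f.
Proof.
move=> fM; apply: bounded_linear_continuous; apply/linear_boundedP.
exists M; split; first exact: num_real.
by move=> r Mr x; apply: le_trans (fM x) _; rewrite ler_wpM2r // ltW.
Qed.

Section WeakCompactness.
Context {R : realType}.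

Lemma weak_continuous_scalar (V : normedModType R) (f : {scalar V}) :
  continuous (f : V -> R) -> continuous (f : weak_topology V -> R).
Proof.
move=> cf x.
pose I := {f : {scalar V} | continuous (f : V -> R)}.
pose Tc (g : I) := Topological.class (initial_topology (projT1 g : V -> R)).
have /(@cvg_sup V I Tc (nbhs (x : weak_topology V)) x)/(_ (exist _ f cf)) fx :
  nbhs (x : weak_topology V) --> (x : weak_topology V) by [].
move=> U fU; apply: fx.
exact: (@initial_continuous V R f x U fU).
Qed.

Context {H : hilbertType R}.

Lemma weak_continuous_inner (h : H) :
  continuous ((fun u => '<<h, u>>_H) : weak_topology H -> R).
Proof.
pose f : {scalar H} :=
  HB.pack (inner h : H -> R) (GRing.isLinear.Build _ _ _ _ _ (inner_scalar h)).
apply: (@weak_continuous_scalar H f) => /=.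
exact: linear_bounded_by_continuous (inner_cauchy_schwarz h).
Qed.

(** The uniform boundedness principle applied to the functionals [inner u] for
    [u] in [K], whose values at each point form a compact set of reals. *)
Lemma weakly_compact_norm_bounded (K : set H) :
  weakly_compact K -> exists M : R, forall u, K u -> `|u| <= M.
Proof.
move=> cK.
have /(_ 1)[M bM] : uniform_bounded [set (inner u : H -> R) | u in K].
  apply: Banach_Steinhauss.
  - move=> _ [u Ku <-]; split; last exact: inner_scalar.
    move=> r; exists (`|u| * r) => x xr.
    by apply: le_trans (inner_cauchy_schwarz u x) _; rewrite ler_wpM2l.
  - move=> h.
    have /compact_bounded[M [_ /(_ (M + 1))]] :
        compact [set '<<h, u>>_H | u in K].
      apply: (@continuous_compact (weak_topology H) R) cK.
      exact/continuous_subspaceT/weak_continuous_inner.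
    rewrite ltrDl ltr01 => /(_ isT) bM.
    exists (M + 1) => _ [u Ku <-]; rewrite innerC.
    by apply: bM; exists u.
(* [`|u|] is the value of [inner u] at the unit vector along [u]. *)
exists M => u Ku.
have [->|u0] := eqVneq u 0.
  have := bM _ (imageP _ Ku) 0; rewrite normr0 => /(_ ler01).
  exact: le_trans.
have nu : 0 < `|u| by rewrite normr_gt0.
have := bM _ (imageP _ Ku) (`|u|^-1 *: u).
rewrite normrZ normfV normr_id mulVf ?gt_eqF // => /(_ (lexx 1)).
rewrite innerZr inner_normE expr2 mulrA mulVf ?gt_eqF // mul1r normr_id.
exact.
Qed.

End WeakCompactness.

(** * Distance to a set *)

Section Distance.
Context {R : realType} {V : normedModType R}.

Lemma dist_to_ge0 (a : V) (N : set V) : (0 <= dist_to a N)%E.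
Proof. by apply: le_ereal_inf_tmp => _ [b _ <-]; rewrite lee_fin. Qed.

Lemma dist_to_mem (a : V) (N : set V) (e : R) :
  0 <= e -> N a -> (dist_to a N <= e%:E)%E.
Proof.
move=> e0 Na; apply: ge_ereal_inf; exists (`|a - a|%:E); first exact: imageP.
by rewrite subrr normr0.
Qed.

Lemma dist_to_lt (a : V) (N : set V) (e : R) :
  (dist_to a N < e%:E)%E -> exists2 b, N b & `|a - b| < e.
Proof. by move=> /ereal_inf_lt[_ [b Nb <-]]; rewrite lte_fin; exists b. Qed.

(** The distances from [a_ n] to [N] need not be attained: [b_ n] is chosen at a
    distance from [a_ n] that is minimal up to [1 / n.+1]. *)
Lemma near_projections (a_ : nat -> V) (N : set V) : N !=set0 ->
  (forall e : R, 0 < e -> \forall n \near \oo, (dist_to (a_ n) N < e%:E)%E) ->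
  exists b_ : nat -> V, (forall n, N (b_ n)) /\
    (a_ n - b_ n) @[n --> \oo] --> (0 : V).
Proof.
move=> [b0 Nb0] aN.
have /choice[b_ bP] : forall n, exists b, N b /\
    forall e : R, (dist_to (a_ n) N < e%:E)%E -> `|a_ n - b| < e + n.+1%:R^-1.
  move=> n; have d0 := dist_to_ge0 (a_ n) N.
  have [dfin|] := boolP (dist_to (a_ n) N \is a fin_num).
    have [|_ [b Nb <-] ab] := @lb_ereal_inf_adherent R _ (n.+1%:R^-1) _ dfin.
      by rewrite invr_gt0.
    exists b; split=> // e de.
    rewrite -lte_fin EFinD; apply: lt_trans ab _.
    by rewrite lteD2rE.
  rewrite ge0_fin_numE // -leNgt leye_eq => /eqP ->.
  by exists b0; split => // e; rewrite ltNge leey.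
exists b_; split; first by move=> n; case: (bP n).
apply/cvgrPdist_lt => e e0; near=> n.
rewrite sub0r normrN [e]splitr.
apply: (@lt_le_trans _ _ (e / 2 + n.+1%:R^-1)).
  by apply: (bP n).2; near: n; apply: aN; rewrite divr_gt0.
rewrite lerD2l ltW //; near: n.
have e2 : 0 < e / 2 by rewrite divr_gt0.
exact: (near_infty_natSinv_lt (PosNum e2)).
Unshelve. all: by end_near. Qed.

End Distance.

(** * Passage to the limit *)

Section Limits.
Context {R : realType}.

Lemma dist_to_near_le_mem (V : normedModType R) (C : set V)
    (x_ : nat -> V) (x : V) (eps_ : nat -> R) :
  closed C -> x_ @ \oo --> x -> eps_ @ \oo --> (0 : R) ->
  (forall n, (dist_to (x_ n) C <= (eps_ n)%:E)%E) -> C x.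
Proof.
move=> cC xx ee dC; apply: cC => U /nbhs_ballP[r /= r0 rU].
have r2 : 0 < r / 2 by rewrite divr_gt0.
have [n [xn en]] : exists n, `|x - x_ n| < r / 2 /\ eps_ n < r / 2.
  near \oo => n; exists n; split; near: n.
    by move/cvgrPdist_lt : xx; apply.
  exact: (cvgr_lt _ ee).
have [c Cc xc] : exists2 c, C c & `|x_ n - c| < r / 2.
  by apply: dist_to_lt; apply: le_lt_trans (dC n) _; rewrite lte_fin.
exists c; split=> //; apply: rU; rewrite -ball_normE /=.
rewrite [r]splitr -(subrKA (x_ n)); apply: le_lt_trans (ler_normD _ _) _.
exact: ltrD.
Unshelve. all: by end_near. Qed.

Lemma H_continuous_dist_to (H X : normedModType R) (B : H * X -> set H)
    (x_ : nat -> H) (p_ : nat -> X) (u_ : nat -> H) (x : H) (p : X) :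
  H_continuous B -> x_ @ \oo --> x -> p_ @ \oo --> p ->
  (forall n, B (x_ n, p_ n) (u_ n)) ->
  forall e : R, 0 < e ->
    \forall n \near \oo, (dist_to (u_ n) (B (x, p)) < e%:E)%E.
Proof.
move=> hB xx pp Bu e e0; have [d d0 dB] := hB (x, p) e e0.
have /cvgrPdist_lt/(_ d d0) : (x_ n, p_ n) @[n --> \oo] --> (x, p).
  exact: cvg_pair.
apply: filterS => n /dB; apply: le_lt_trans.
rewrite /hausdorff_dist le_max; apply/orP; right.
by apply: ereal_sup_ubound; exists (u_ n).
Qed.

(** The multipliers [u_ n] are asymptotic to elements of the weakly compact
    limit value, and [u] is a weak cluster point of the latter. *)
Lemma variational_inequality_limit (H : hilbertType R) (X : normedModType R)
    (C : set H) (phi : H * X -> R) (B : H * X -> set H)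
    (x_ : nat -> H) (p_ : nat -> X) (u_ : nat -> H) (eps_ : nat -> R)
    (x : H) (p : X) :
  continuous phi -> strict_map B -> weakly_compact_valued B -> H_continuous B ->
  x_ @ \oo --> x -> p_ @ \oo --> p -> eps_ @ \oo --> (0 : R) ->
  (forall n, B (x_ n, p_ n) (u_ n)) ->
  (forall n c, C c ->
    '<<u_ n, x_ n - c>>_H + phi (x_ n, p_ n) - phi (c, p_ n) <= eps_ n) ->
  exists2 u, B (x, p) u &
    forall c, C c -> '<<u, x - c>>_H + phi (x, p) - phi (c, p) <= 0.
Proof.
move=> cphi sB wB hB xx pp ee Bu ineq.
have [w_ [Bw uw]]
  := near_projections (sB (x, p)) (H_continuous_dist_to hB xx pp Bu).
have [M bM] := weakly_compact_norm_bounded (wB (x, p)).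
have [u [Bxu clu]] : exists u, (B (x, p) `&`
    @cluster (weak_topology H) (w_ @ \oo)) u.
  by apply: (wB (x, p)); exists 0%N => // n _; exact: Bw.
exists u => // c Cc; apply/ler_addgt0Pr => e e0; rewrite add0r.
have e4 : 0 < e / 4 by rewrite divr_gt0.
have phi_x : phi (x_ n, p_ n) @[n --> \oo] --> phi (x, p).
  by apply: (cvg_comp _ phi (cvg_pair xx pp)); exact: cphi.
have phi_c : phi (c, p_ n) @[n --> \oo] --> phi (c, p).
  by apply: (cvg_comp _ phi (cvg_pair (cvg_cst c) pp)); exact: cphi.
have err0 : `|u_ n - w_ n| * `|x_ n - c| + M * `|x_ n - x|
    @[n --> \oo] --> (0 : R).
  rewrite [X in _ --> X](_ : _ =
    `|0 : H| * `|x - c| + M * `|x - x|); last first.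
    by rewrite subrr !normr0 mul0r mulr0 addr0.
  apply: cvgD.
    by apply: cvgM; apply: cvg_norm => //; apply: cvgB => //; exact: cvg_cst.
  by apply: cvgMr; apply: cvg_norm; apply: cvgB => //; exact: cvg_cst.
have wx : \forall n \near \oo,
    '<<w_ n, x - c>>_H <= phi (c, p) - phi (x, p) + e / 4 * 3.
  near=> n.
  have inn : '<<w_ n, x - c>>_H <= '<<u_ n, x_ n - c>>_H +
      (`|u_ n - w_ n| * `|x_ n - c| + M * `|x_ n - x|).
    have -> : '<<w_ n, x - c>>_H = '<<u_ n, x_ n - c>>_H -
        ('<<u_ n - w_ n, x_ n - c>>_H + '<<w_ n, x_ n - x>>_H).
      rewrite innerBl !innerBr; ring.
    rewrite lerD2l; apply: le_trans (ler_norm _) _.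
    rewrite normrN; apply: le_trans (ler_normD _ _) _; apply: lerD.
      exact: inner_cauchy_schwarz.
    apply: le_trans (inner_cauchy_schwarz _ _) _.
    by rewrite ler_wpM2r // bM.
  have h1 := ineq n c Cc.
  have h2 : eps_ n < e / 4 by near: n; exact: (cvgr_lt _ ee).
  have h3 : `|u_ n - w_ n| * `|x_ n - c| + M * `|x_ n - x| < e / 4 / 2.
    by near: n; apply: (cvgr_lt _ err0); rewrite divr_gt0.
  have h4 : phi (x, p) - e / 4 < phi (x_ n, p_ n).
    by near: n; apply: (cvgr_gt _ phi_x); rewrite ltrBlDr ltrDl.
  have h5 : phi (c, p_ n) < phi (c, p) + e / 4 / 2.
    by near: n; apply: (cvgr_lt _ phi_c); rewrite ltrDl divr_gt0.
  lra.
have cu := @weak_continuous_inner R H (x - c) u.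
have lt_u : '<<u, x - c>>_H - e / 4 < '<<x - c, u>>_H.
  by rewrite (innerC u) ltrBlDr ltrDl.
have [w [/= w1]] := clu
  [set w | '<<w, x - c>>_H <= phi (c, p) - phi (x, p) + e / 4 * 3] _
  wx (cvgr_gt _ cu _ lt_u).
rewrite (innerC (x - c) w) => w2; lra.
Unshelve. all: by end_near. Qed.

End Limits.

(** * Norm and diameter in the product *)

Section ProductNorm.
Context {R : realType} {H1 H2 : hilbertType R}.
Implicit Types (z : H1 * H2) (S : R -> R -> set (H1 * H2)).

Lemma norm_le_hprod_norm z : `|z| <= hprod_norm z.
Proof.
rewrite /hprod_norm prod_normE ge_max.
by rewrite -{1}(ger0_norm (normr_ge0 z.1)) -{2}(ger0_norm (normr_ge0 z.2))
  -!sqrtr_sqr !ler_wsqrtr ?lerDl ?lerDr ?sqr_ge0.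
Qed.

Lemma hprod_norm_le_norm z : hprod_norm z <= 2 * `|z|.
Proof.
have z1 : `|z.1| <= `|z| by rewrite prod_normE le_max lexx.
have z2 : `|z.2| <= `|z| by rewrite prod_normE le_max lexx orbT.
rewrite -[leRHS]ger0_norm ?mulr_ge0 // -sqrtr_sqr ler_wsqrtr //.
have := normr_ge0 z.1; have := normr_ge0 z.2; nra.
Qed.

Lemma hprod_norm_ge0 z : 0 <= hprod_norm z.
Proof. exact: sqrtr_ge0. Qed.

(** By monotonicity, sets with two equal indices suffice. Nonemptiness excludes
    the value [-oo] of [hprod_diam] at the empty set. *)
Lemma hprod_diam_cvg0P S :
  (forall d d' e e', d <= d' -> e <= e' -> S d e `<=` S d' e') ->
  (forall d e, 0 < d -> 0 < e -> S d e !=set0) ->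
  hprod_diam (S de.1 de.2)
      @[de --> within [set de : R * R | 0 < de.1 /\ 0 < de.2]
                 (nbhs ((0, 0) : R * R))] --> (0%:E : \bar R) <->
  forall r : R, 0 < r -> exists2 d : R, 0 < d &
    forall a b, S d d a -> S d d b -> hprod_norm (a - b) <= r.
Proof.
move=> mS S0; split=> [diam0 r r0|diam0].
  have : nbhs (0%:E : \bar R) [set y | (y < r%:E)%E].
    by apply: open_nbhs_nbhs; split;
      [exact: open_ereal_lt_ereal|rewrite /= lte_fin].
  move=> /diam0 diam_lt.
  have /nbhs_ballP[e /= e0 eS] : nbhs ((0, 0) : R * R)
      [set de | 0 < de.1 /\ 0 < de.2 -> (hprod_diam (S de.1 de.2) < r%:E)%E].
    exact: diam_lt.
  have e2 : 0 < e / 2 by rewrite divr_gt0.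
  exists (e / 2) => // a b Sa Sb.
  have /eS : ball ((0, 0) : R * R) e (e / 2, e / 2).
    by split; rewrite -ball_normE /= sub0r normrN gtr0_norm //
      ltr_pdivrMr // ltr_pMr // ltrDl.
  move=> /(_ (conj e2 e2)) /ltW; rewrite -lee_fin; apply: le_trans.
  by apply: ereal_sup_ubound; exists a => //; exists b.
have dP (r : R) : 0 < r ->
    \forall de \near within [set de : R * R | 0 < de.1 /\ 0 < de.2]
                 (nbhs ((0, 0) : R * R)),
    (0%:E <= hprod_diam (S de.1 de.2) <= r%:E)%E.
  move=> /diam0[d d0 dS]; rewrite near_withinE.
  apply/nbhs_ballP; exists d => //= -[d1 d2] [/=].
  rewrite -!ball_normE /= !sub0r !normrN => l1 l2 [d10 d20].
  have sub : S d1 d2 `<=` S d d.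
    by apply: mS; apply: ltW; apply: le_lt_trans (ler_norm _) _.
  apply/andP; split.
    have [a Sa] := S0 _ _ d10 d20.
    apply: (@le_trans _ _ (hprod_norm (a - a))%:E).
      by rewrite lee_fin hprod_norm_ge0.
    by apply: ereal_sup_ubound; exists a => //; exists a.
  apply: ge_ereal_sup => _ [a Sa [b Sb <-]]; rewrite lee_fin.
  by apply: dS; exact: sub.
have FF : Filter (within [set de : R * R | 0 < de.1 /\ 0 < de.2]
                 (nbhs ((0, 0) : R * R))) by exact: within_filter.
apply/fine_cvgP; split.
  apply: filterS (dP 1 ltr01) => de /andP[ge0 le1].
  by rewrite ge0_fin_numE //; apply: le_lt_trans le1 _; exact: ltry.
apply/cvgrPdist_le => r /dP; apply: filterS => de /andP[ge0 le1].
rewrite sub0r normrN /= ger0_norm ?fine_ge0 //.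
by rewrite -lee_fin fineK // ge0_fin_numE //;
  apply: le_lt_trans le1 _; exact: ltry.
Qed.

End ProductNorm.

(** * Approximate solutions *)

Section Problem.
Context {R : realType} {H1 H2 : hilbertType R} {X : completeNormedModType R}.
Variables (C : set H1) (Q : set H2).
Variables (phi : H1 * X -> R) (psi : H2 * X -> R).
Variables (B1 : H1 * X -> set H1) (B2 : H2 * X -> set H2).
Variable A : {linear H1 -> H2}.

Local Notation solutions := (psmvip_solutions C Q phi psi B1 B2 A).
Local Notation approx := (psmvip_approx C Q phi psi B1 B2 A).
Local Notation approx_solutions :=
  (psmvip_approx_solutions C Q phi psi B1 B2 A).
Local Notation approximating_seq :=
  (generalized_approximating_seq C Q phi psi B1 B2 A).

Lemma psmvip_approx_le q e e' z u v :
  e <= e' -> approx q e z u v -> approx q e' z u v.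
Proof.
move=> ee [Buv [[dC dQ dA] [uC vQ]]]; split=> //; split; first split.
- by apply: le_trans dC _; rewrite lee_fin.
- by apply: le_trans dQ _; rewrite lee_fin.
- exact: le_trans ee.
by split=> [x Cx|y Qy]; apply: le_trans ee; [exact: uC|exact: vQ].
Qed.

Lemma psmvip_approx_solutions_mono p d d' e e' : d <= d' -> e <= e' ->
  approx_solutions p d e `<=` approx_solutions p d' e'.
Proof.
move=> dd ee z [q pq [u [v h]]]; exists q; first exact: le_trans dd.
by exists u, v; exact: psmvip_approx_le h.
Qed.

Lemma psmvip_solutions_sub_approx p d e : 0 < d -> 0 < e ->
  solutions p `<=` approx_solutions p d e.
Proof.
move=> d0 e0 z [u [v [[Bu Bv Cz Qz zA] [uC vQ]]]]; exists p.
  by rewrite /closed_ball_ /= subrr normr0 ltW.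
exists u, v; split=> //; split; first split.
- by apply: dist_to_mem => //; exact: ltW.
- by apply: dist_to_mem => //; exact: ltW.
- by rewrite zA subrr normr0 ltW.
by split=> [x Cx|y Qy]; apply: le_trans (ltW e0); [exact: uC|exact: vQ].
Qed.

Lemma approx_solutions_approximating_seq p (z_ : nat -> H1 * H2) :
  (forall n, approx_solutions p n.+1%:R^-1 n.+1%:R^-1 (z_ n)) ->
  exists2 p_ : nat -> X, p_ @ \oo --> p & approximating_seq p_ z_.
Proof.
move=> zS.
have /choice[p_ p_P] : forall n, exists q, `|p - q| <= n.+1%:R^-1 /\
    exists u v, approx q n.+1%:R^-1 (z_ n) u v.
  by move=> n; have [q pq zq] := zS n; exists q.
have /choice[u_ u_P] n := (p_P n).2.
have /choice[v_ v_P] := u_P.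
exists p_.
  apply/cvgrPdist_lt => e e0; near=> n.
  apply: le_lt_trans (p_P n).1 _; near: n.
  exact: (near_infty_natSinv_lt (PosNum e0)).
exists u_, v_, (fun n => n.+1%:R^-1); split=> //.
exact: cvg_harmonic.
Unshelve. all: by end_near. Qed.

Lemma approximating_seq_near p p_ z_ d :
  p_ @ \oo --> p -> approximating_seq p_ z_ -> 0 < d ->
  \forall n \near \oo, approx_solutions p d d (z_ n).
Proof.
move=> pp [u_ [v_ [eps_ [_ ee h]]]] d0; near=> n; exists (p_ n).
  by near: n; move/cvgrPdist_le : pp; apply.
exists (u_ n), (v_ n); apply: psmvip_approx_le (h n).
by near: n; apply: (cvgr_le _ ee).
Unshelve. all: by end_near. Qed.

(** A sequence of approximate solutions with tolerances [1 / n.+1] staying away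
    from [zbar] would be an approximating sequence not converging to [zbar]. *)
Lemma approx_solutions_near_of_seq p zbar :
  (forall p_ : nat -> X, p_ @ \oo --> p -> forall z_, approximating_seq p_ z_ ->
     hprod_norm (z_ n - zbar) @[n --> \oo] --> (0 : R)) ->
  forall r : R, 0 < r -> exists2 d : R, 0 < d &
    forall z, approx_solutions p d d z -> hprod_norm (z - zbar) <= r.
Proof.
move=> wp r r0; apply: contrapT => nd.
have /choice[z_ zP] n : exists z, approx_solutions p n.+1%:R^-1 n.+1%:R^-1 z /\
    r < hprod_norm (z - zbar).
  apply: contrapT => nz; apply: nd; exists n.+1%:R^-1.
    by rewrite invr_gt0.
  by move=> z zS; rewrite leNgt; apply/negP => rz; apply: nz; exists z.
have [p_ pp zseq]
  := @approx_solutions_approximating_seq p z_ (fun n => (zP n).1).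
have [n] : exists n, hprod_norm (z_ n - zbar) < r.
  near \oo => n; exists n; near: n; exact: (cvgr_lt _ (wp p_ pp z_ zseq)).
by rewrite ltNge ltW //; exact: (zP n).2.
Unshelve. all: by end_near. Qed.

Hypotheses (C_closed : closed C) (Q_closed : closed Q).
Hypotheses (phi_continuous : continuous phi) (psi_continuous : continuous psi).
Hypotheses (B1_strict : strict_map B1) (B1_wcompact : weakly_compact_valued B1)
  (B1_Hcontinuous : H_continuous B1).
Hypotheses (B2_strict : strict_map B2) (B2_wcompact : weakly_compact_valued B2)
  (B2_Hcontinuous : H_continuous B2).
Hypothesis A_bounded : exists M : R, forall x : H1, `|A x| <= M * `|x|.

Lemma approximating_seq_limit p_ z_ p z :
  p_ @ \oo --> p -> approximating_seq p_ z_ -> z_ @ \oo --> z -> solutions p z.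
Proof.
move=> pp [u_ [v_ [eps_ [_ ee h]]]] zz.
have z1 : (z_ n).1 @[n --> \oo] --> z.1 by apply: cvg_comp zz _; exact: cvg_fst.
have z2 : (z_ n).2 @[n --> \oo] --> z.2 by apply: cvg_comp zz _; exact: cvg_snd.
have cA : continuous A.
  by have [M AM] := A_bounded; exact: linear_bounded_by_continuous AM.
have Az : z.2 = A z.1.
  have z2A : (z_ n).2 - A (z_ n).1 @[n --> \oo] --> z.2 - A z.1.
    by apply: cvgB => //; apply: cvg_comp z1 _; exact: cA.
  have z2A0 : (z_ n).2 - A (z_ n).1 @[n --> \oo] --> (0 : H2).
    apply/cvgr0Pnorm_lt => e e0; near=> n.
    have [_ [[_ _ le_eps] _]] := h n.
    by apply: le_lt_trans le_eps _; near: n; exact: (cvgr_lt _ ee).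
  by apply/subr0_eq; exact: cvg_unique z2A z2A0.
have [u Bu uC]
  := variational_inequality_limit phi_continuous B1_strict B1_wcompact
  B1_Hcontinuous z1 pp ee (fun n => (h n).1.1) (fun n => (h n).2.2.1).
have [v Bv vQ]
  := variational_inequality_limit psi_continuous B2_strict B2_wcompact
  B2_Hcontinuous z2 pp ee (fun n => (h n).1.2) (fun n => (h n).2.2.2).
exists u, v; split; last by [].
split=> //.
  by apply: (dist_to_near_le_mem C_closed z1 ee) => n; have [_ [[]]] := h n.
by apply: (dist_to_near_le_mem Q_closed z2 ee) => n; have [_ [[]]] := h n.
Unshelve. all: by end_near. Qed.

Lemma solution_exists p :
  (forall d e : R, 0 < d -> 0 < e -> approx_solutions p d e !=set0) ->
  (forall r : R, 0 < r -> exists2 d : R, 0 < d & forall a b,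
     approx_solutions p d d a -> approx_solutions p d d b ->
     hprod_norm (a - b) <= r) ->
  solutions p !=set0.
Proof.
move=> S0 diam0.
have n0 n : 0 < n.+1%:R^-1 :> R by rewrite invr_gt0.
have /choice[z_ zS] n := S0 _ _ (n0 n) (n0 n).
have [p_ pp zseq] := approx_solutions_approximating_seq zS.
have near_z e : 0 < e -> exists N, \forall n \near \oo, `|z_ N - z_ n| < e.
  move=> e0; have [d d0 dS] := diam0 (e / 2) (divr_gt0 e0 (ltr0n _ 2)).
  have zd := approximating_seq_near pp zseq d0.
  have [N zN] := filter_ex zd.
  exists N; apply: filterS zd => n zn.
  apply: le_lt_trans (norm_le_hprod_norm _) _.
  apply: le_lt_trans (dS _ _ zN zn) _.
  by rewrite ltr_pdivrMr // ltr_pMr // ltrDl.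
have /cvg_ex[z1 z1P] : cvg ((z_ n).1 @[n --> \oo]).
  apply/cauchy_cvgP/cauchy_exP => e /near_z[N zN].
  exists (z_ N).1; apply: filterS zN => n; rewrite -ball_normE prod_normE /=.
  by rewrite gt_max => /andP[].
have /cvg_ex[z2 z2P] : cvg ((z_ n).2 @[n --> \oo]).
  apply/cauchy_cvgP/cauchy_exP => e /near_z[N zN].
  exists (z_ N).2; apply: filterS zN => n; rewrite -ball_normE prod_normE /=.
  by rewrite gt_max => /andP[].
exists (z1, z2); apply: approximating_seq_limit pp zseq _.
rewrite (_ : z_ = fun n => ((z_ n).1, (z_ n).2)); first exact: cvg_pair.
by apply/funext => n; case: (z_ n).
Qed.

End Problem.

Unset Implicit Arguments.

Theorem theorem13 (R : realType) (H1 H2 : hilbertType R)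
    (C : set H1) (Q : set H2)
    (C_nonempty : C !=set0) (C_closed : closed C) (C_convex : convex_set C)
    (Q_nonempty : Q !=set0) (Q_closed : closed Q) (Q_convex : convex_set Q)
    (X : completeNormedModType R)
    (phi : H1 * X -> R) (psi : H2 * X -> R)
    (phi_continuous : continuous phi) (psi_continuous : continuous psi)
    (B1 : H1 * X -> set H1) (B2 : H2 * X -> set H2)
    (B1_strict : strict_map B1) (B1_wcompact : weakly_compact_valued B1)
    (B1_Hcontinuous : H_continuous B1)
    (B2_strict : strict_map B2) (B2_wcompact : weakly_compact_valued B2)
    (B2_Hcontinuous : H_continuous B2)
    (A : {linear H1 -> H2})
    (A_bounded : exists M : R, forall x : H1, `|A x| <= M * `|x|) :
  LP_well_posed C Q phi psi B1 B2 A <->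
  forall p : X,
    (forall delta eps : R, 0 < delta -> 0 < eps ->
      psmvip_approx_solutions C Q phi psi B1 B2 A p delta eps !=set0) /\
    hprod_diam (psmvip_approx_solutions C Q phi psi B1 B2 A p de.1 de.2)
      @[de --> within [set de : R * R | 0 < de.1 /\ 0 < de.2]
                 (nbhs ((0, 0) : R * R))] --> (0%:E : \bar R).
Proof.
split=> [wp p|diam0 p].
  have [zbar [solP conv]] := wp p.
  have S0 (d e : R) : 0 < d -> 0 < e ->
      psmvip_approx_solutions C Q phi psi B1 B2 A p d e !=set0.
    move=> d0 e0; exists zbar; apply: psmvip_solutions_sub_approx => //.
    by rewrite solP.
  split=> //; apply/hprod_diam_cvg0P => //.
    by move=> *; exact: psmvip_approx_solutions_mono.
  (* A factor 2 from the triangle inequality through [zbar], and a factor 2 from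
     comparing [hprod_norm] with the max norm, which has that inequality. *)
  move=> r r0; have r4 : 0 < r / 4 by rewrite divr_gt0.
  have [d d0 dS] := approx_solutions_near_of_seq conv r4.
  exists d => // a b /dS az /dS bz.
  have := norm_le_hprod_norm (a - zbar); have := norm_le_hprod_norm (b - zbar).
  have := ler_distD zbar a b; rewrite (distrC zbar b).
  have := hprod_norm_le_norm (a - b); lra.
have [S0 diam0p] := diam0 p.
have {diam0p} dS : forall r : R, 0 < r -> exists2 d : R, 0 < d & forall a b,
    psmvip_approx_solutions C Q phi psi B1 B2 A p d d a ->
    psmvip_approx_solutions C Q phi psi B1 B2 A p d d b ->
    hprod_norm (a - b) <= r.
  apply/hprod_diam_cvg0P => //.
  by move=> *; exact: psmvip_approx_solutions_mono.
have [zbar solz]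
  := solution_exists C_closed Q_closed phi_continuous psi_continuous
  B1_strict B1_wcompact B1_Hcontinuous B2_strict B2_wcompact B2_Hcontinuous
  A_bounded S0 dS.
exists zbar; split.
  apply/seteqP; split=> [z zsol|_ -> //].
  apply/eqP; rewrite -subr_eq0 -normr_le0; apply/ler_addgt0Pr => r /dS[d d0 dr].
  rewrite add0r; apply: le_trans (norm_le_hprod_norm _) _.
  by apply: dr; exact: psmvip_solutions_sub_approx.
move=> p_ pp z_ zseq; apply/cvgr0Pnorm_le => r /dS[d d0 dr].
apply: filterS (approximating_seq_near pp zseq d0) => n zn.
rewrite ger0_norm ?hprod_norm_ge0 //; apply: dr => //.
exact: psmvip_solutions_sub_approx.
Qed.
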